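(* Let $m>2$ be an integer, $q=2^m$, $\mathbb{F}_q=\{\alpha_1,\ldots,\alpha_q\}$, and let $k\ge3$, $t\ge1$, $h\ge0$, $n$ be integers with $t+h\le k-1$, $\frac{q-2t+1}{2}<k<\frac{q-t+1}{2}$ and $2k+t\le n\le q$. If $\eta\in\mathbb{F}_q^{*}$, $\boldsymbol{\alpha}=(\alpha_{i_1},\ldots,\alpha_{i_n})$ with $1\le i_1<\cdots<i_n\le q$, and $\boldsymbol{v}=(v_1,\ldots,v_n)$ with $$v_j=\prod_{\beta\in\mathbb{F}_{2^m}\setminus\{\alpha_{i_1},\ldots,\alpha_{i_n}\}}(\alpha_{i_j}-\beta)^{2^{m-1}}\quad(j=1,\ldots,n),$$ then $\mathcal{C}_{\mathcal{V}_{k,t,h,\eta}}(\boldsymbol{\alpha},\boldsymbol{v})$ is self-orthogonal.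
   Context: $\alpha_1,\ldots,\alpha_q$ are all the elements of $\mathbb{F}_q$; $\mathbb{F}_q^*=\mathbb{F}_q\setminus\{0\}$. For $h\le k-1$ and $\eta\in\mathbb{F}_q^*$, $$\mathcal{V}_{k,t,h,\eta}=\Big\{\sum_{i=0}^{k-1}a_ix^i+\eta a_hx^{k-1+t}\ \Big|\ a_0,\ldots,a_{k-1}\in\mathbb{F}_q\Big\},$$ $$\mathcal{C}_{\mathcal{V}_{k,t,h,\eta}}(\boldsymbol{\alpha},\boldsymbol{v})=\{(v_1f(\alpha_{i_1}),\ldots,v_nf(\alpha_{i_n}))\mid f\in\mathcal{V}_{k,t,h,\eta}\}.$$ A linear code $\mathcal{C}\subseteq\mathbb{F}_q^n$ is self-orthogonal if $\mathcal{C}\subseteq\mathcal{C}^\perp$ with respect to the Euclidean inner product. Empty products equal $1$. *)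

(* Defs.v *)
From HB Require Import structures.
From mathcomp Require Export all_boot all_order all_algebra.
From mathcomp Require Export boolp classical_sets.

Set Implicit Arguments.
Unset Strict Implicit.
Unset Printing Implicit Defensive.

Import Order.TTheory GRing.Theory Num.Theory.
Local Open Scope ring_scope.
Local Open Scope classical_set_scope.

(* Meant for h < k.  The coefficients are given by a sequence a : nat -> F, of
   which only a 0, ..., a (k - 1) are used in that range. *)
Definition twisted_poly (F : fieldType) (k t h : nat) (eta : F)
    (a : nat -> F) : {poly F} :=
  \sum_(i < k) a i *: 'X^i + (eta * a h) *: 'X^(k - 1 + t).

Definition twisted_space (F : fieldType) (k t h : nat) (eta : F) :
    set {poly F} :=
  [set f | exists a : nat -> F, f = twisted_poly k t h eta a].

Definition eval_code (F : fieldType) (n : nat) (V : set {poly F})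
    (alpha v : 'rV[F]_n) : set 'rV[F]_n :=
  [set c | exists2 f : {poly F}, V f & c = \row_j (v 0 j * f.[alpha 0 j])].

Definition linear_code (F : fieldType) (n : nat) (C : set 'rV[F]_n) : Prop :=
  C 0 /\ (forall (a : F) (x y : 'rV[F]_n), C x -> C y -> C (a *: x + y)).

Definition inner_prod (F : fieldType) (n : nat) (x y : 'rV[F]_n) : F :=
  \sum_(j < n) x 0 j * y 0 j.

Definition dual_code (F : fieldType) (n : nat) (C : set 'rV[F]_n) :
    set 'rV[F]_n :=
  [set x | forall y : 'rV[F]_n, C y -> inner_prod x y = 0].

Definition self_orthogonal (F : fieldType) (n : nat) (C : set 'rV[F]_n) :
    Prop :=
  C `<=` dual_code C.

Lemma twisted_code_linear (F : fieldType) (k t h n : nat) (eta : F)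
    (alpha v : 'rV[F]_n) :
  linear_code (eval_code (twisted_space k t h eta) alpha v).
Proof.
have twP (c : F) a b : twisted_poly k t h eta (fun i => c * a i + b i) =
    c *: twisted_poly k t h eta a + twisted_poly k t h eta b.
  rewrite /twisted_poly scalerDr scaler_sumr addrACA -big_split /=.
  congr (_ + _); last by rewrite scalerA -scalerDl mulrDr mulrCA.
  by apply: eq_bigr => i _; rewrite scalerA -scalerDl.
split.
  exists (twisted_poly k t h eta (fun=> 0)); first by exists (fun=> 0).
  apply/rowP => j; rewrite !mxE /twisted_poly mulr0 scale0r addr0.
  by rewrite big1 ?horner0 ?mulr0 // => i _; rewrite scale0r.
move=> c x y [_ [a ->] ->] [_ [b ->] ->].
exists (c *: twisted_poly k t h eta a + twisted_poly k t h eta b).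
  by exists (fun i => c * a i + b i); exact: esym (twP c a b).
apply/rowP => j; rewrite !mxE.
move: (twisted_poly k t h eta a) (twisted_poly k t h eta b) => f g.
by rewrite hornerD hornerZ mulrDr mulrCA.
Qed.

(* Main.v *)
(** Squaring the multipliers gives [v_j ^ 2 = P (alpha_j)], where [P] is the monic
    polynomial of degree [q - n] vanishing exactly off the evaluation set.  Hence the
    inner product of the codewords of [f] and [g] is the sum of [P f g] over the
    whole field.  As [deg (P f g) <= q - 2 + t < 2 (q - 1)], this sum is minus the
    coefficient of [X^(q-1)] in [P f g].  By [n >= 2k + t] the products involving an
    untwisted part of [f] or [g] have degree below [q - 1]; the product of the two
    twists is divisible by [X^(2(k-1+t))] with [2(k-1+t) > q - 1]. *)
Require Import Defs.
From mathcomp Require Import all_boot all_order all_algebra all_field.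
From mathcomp Require Import boolp classical_sets.
From mathcomp Require Import zify lra.

Set Implicit Arguments.
Unset Strict Implicit.
Unset Printing Implicit Defensive.

Import Order.TTheory GRing.Theory Num.Theory.
Local Open Scope ring_scope.

(** For [0 < i], the polynomial ['X^i - 1] has too few roots to vanish on all nonzero elements, so
    some [y != 0] has [y ^+ i != 1]; substituting [y * x] for [x] multiplies the sum by [y ^+ i],
    which forces it to be 0. *)
Lemma sum_exp_lt_card (F : finFieldType) (i : nat) :
  (i < #|F|.-1)%N -> \sum_(x : F) x ^+ i = 0.
Proof.
case: i => [_|i lt_i].
  (* For exponent 0 the sum of ones vanishes because the translation [x + 1] permutes the field. *)
  apply: (addrI (\sum_(x : F) x)); rewrite addr0 -big_split /=.
  rewrite [RHS](reindex_inj (addIr 1)) /=.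
  by apply: eq_bigr => x _; rewrite expr0.
have [y y0 yi] : exists2 y : F, y != 0 & y ^+ i.+1 != 1.
  apply/exists_inP; apply: contraTT lt_i => /exists_inPn all1.
  rewrite -leqNgt.
  have pE : size ('X^(i.+1) - 1%:P : {poly F}) = i.+2 by rewrite size_XnsubC.
  have p0 : 'X^(i.+1) - 1%:P != 0 :> {poly F} by rewrite -size_poly_gt0 pE.
  have rs : all (root ('X^(i.+1) - 1%:P)) (enum (predC1 (0 : F))).
    apply/allP => x; rewrite mem_enum inE => x0.
    rewrite rootE hornerD hornerN hornerXn hornerC subr_eq0.
    by have := all1 x x0; rewrite negbK.
  have := max_poly_roots p0 rs (enum_uniq _).
  by rewrite pE ltnS -cardE cardC1.
have sumM : \sum_(x : F) x ^+ i.+1 = y ^+ i.+1 * \sum_(x : F) x ^+ i.+1.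
  rewrite {1}(reindex_inj (mulfI y0)) mulr_sumr /=.
  by apply: eq_bigr => x _; rewrite exprMn.
apply: contraNeq yi => S0; apply/eqP/(mulIf S0).
by rewrite mul1r -sumM.
Qed.

(** Among the exponents allowed by the size bound, only [#|F|.-1] has a nonzero power sum; the next
    such exponent, [2 * #|F|.-1], is just excluded. *)
Lemma sum_horner_eq0 (F : finFieldType) (p : {poly F}) :
  (size p <= 2 * #|F|.-1)%N -> p`_(#|F|.-1) = 0 -> \sum_(x : F) p.[x] = 0.
Proof.
move=> szp p0; under eq_bigr => x _ do rewrite horner_coef.
rewrite exchange_big big1 //= => i _; rewrite -mulr_sumr.
have [lti|gti|->] := ltngtP i #|F|.-1; last by rewrite p0 mul0r.
  by rewrite sum_exp_lt_card ?mulr0.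
have qgt1 := finNzRing_gt1 F.
have lei : (i < 2 * #|F|.-1)%N := leq_trans (ltn_ord i) szp.
(* Since [i >= #|F|], the reduction can use [x ^+ #|F| = x], which holds at 0 too. *)
rewrite (eq_bigr (fun x => x ^+ (i - #|F|.-1))) => [|x _].
  by rewrite sum_exp_lt_card ?mulr0 //; lia.
rewrite -{1}(subnKC gti) prednK ?exprD ?expf_card -?exprS; last by lia.
by congr (_ ^+ _); lia.
Qed.

(** With [s] the evaluation points, this is the polynomial whose values on [s] are the squared
    multipliers. *)
Definition vanishing_poly (F : finFieldType) (s : seq F) : {poly F} :=
  \prod_(b : F | b \notin s) ('X - b%:P).

Lemma size_vanishing_poly (F : finFieldType) (s : seq F) :
  uniq s -> size (vanishing_poly s) = (#|F| - size s).+1.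
Proof.
move=> us; rewrite /vanishing_poly -big_enum /= size_prod_XsubC -cardE.
have := cardC (mem s); rewrite (card_uniqP us) => <-.
by rewrite addKn; congr _.+1; apply: eq_card => x; rewrite !inE.
Qed.

Lemma vanishing_poly_eq0 (F : finFieldType) (s : seq F) (x : F) :
  x \notin s -> (vanishing_poly s).[x] = 0.
Proof.
by move=> xs; rewrite horner_prod (bigD1 x) //= hornerXsubC subrr mul0r.
Qed.

Lemma sum_seq_vanishing_poly (F : finFieldType) (s : seq F) (p : {poly F}) :
  uniq s ->
  \sum_(x <- s) (vanishing_poly s * p).[x] =
  \sum_(x : F) (vanishing_poly s * p).[x].
Proof.
move=> us; rewrite big_uniq //= [RHS](bigID (mem s)) /= [X in _ + X]big1 ?addr0 //.
by move=> x xs; rewrite hornerM vanishing_poly_eq0 ?mul0r.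
Qed.

(** Raising to the power [2 ^ (m - 1)] is the inverse of squaring, because [y ^+ (2 ^ m) = y] on
    [F]. *)
Lemma sqr_prod_half_card (F : finFieldType) (m : nat) (s : seq F) (x : F) :
  (0 < m)%N -> #|F| = (2 ^ m)%N ->
  (\prod_(b : F | b \notin s) (x - b) ^+ (2 ^ (m - 1))) ^+ 2 =
  (vanishing_poly s).[x].
Proof.
move=> m0 cF; rewrite horner_prod -prodrXl; apply: eq_bigr => b _.
by rewrite -exprM -expnSr subn1 prednK // -cF expf_card hornerXsubC.
Qed.

Lemma size_sum_scaleXn (R : nzRingType) (k : nat) (a : nat -> R) :
  (size (\sum_(i < k) a i *: 'X^i)%R <= k)%N.
Proof. by rewrite -poly_def size_poly. Qed.

Lemma size_mul_leq (R : nzRingType) (p q : {poly R}) (m n d : nat) :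
  (size p <= m)%N -> (size q <= n)%N -> (m + n <= d.+1)%N ->
  (size (p * q)%R <= d)%N.
Proof. by move=> pm qn; have := size_polyMleq p q; lia. Qed.

Lemma size_scaleXn_leq (R : nzRingType) (c : R) (n : nat) :
  (size (c *: 'X^n)%R <= n.+1)%N.
Proof. by rewrite (leq_trans (size_scale_leq _ _)) // size_polyXn. Qed.

Lemma size_twisted_poly (F : fieldType) (k t h : nat) (eta : F) (a : nat -> F) :
  (size (twisted_poly k t h eta a) <= (k - 1 + t).+1)%N.
Proof.
rewrite /twisted_poly (leq_trans (size_polyD _ _)) // geq_max size_scaleXn_leq.
by rewrite andbT (leq_trans (size_sum_scaleXn _ _)) //; lia.
Qed.

Lemma coef_mul_twisted_poly (F : fieldType) (k t h d : nat) (eta : F)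
    (a b : nat -> F) (P : {poly F}) :
  (size P + (2 * k - 1 + t) <= d.+1)%N -> (d < 2 * (k - 1 + t))%N -> (0 < k)%N ->
  (P * (twisted_poly k t h eta a * twisted_poly k t h eta b))`_d = 0.
Proof.
move=> szP ltd k0; rewrite /twisted_poly.
set f0 := \sum_(i < k) a i *: _; set g0 := \sum_(i < k) b i *: _.
set f1 := _ *: 'X^ _; set g1 := (eta * b h) *: 'X^ _.
have szf0 : (size f0 <= k)%N := size_sum_scaleXn _ _.
have szg0 : (size g0 <= k)%N := size_sum_scaleXn _ _.
have szf1 : (size f1 <= (k - 1 + t).+1)%N := size_scaleXn_leq _ _.
have szg : (size (g0 + g1)%R <= (k - 1 + t).+1)%N by exact: size_twisted_poly.
(* Each of the first two products has one factor of size at most [k] and one of size at most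
   [k + t], hence size at most [2 * k - 1 + t]. *)
have -> : (f0 + f1) * (g0 + g1) = f0 * (g0 + g1) + f1 * g0 + f1 * g1.
  by rewrite mulrDl (mulrDr f1) addrA.
have szd (p : {poly F}) : (size p <= 2 * k - 1 + t)%N -> (P * p)`_d = 0.
  move=> szp; rewrite nth_default //.
  exact: size_mul_leq (leqnn _) szp szP.
rewrite !(mulrDr P) !coefD (szd (f0 * _)) ?(szd (f1 * g0)) ?add0r.
- rewrite /f1 /g1 -scalerAl -!scalerAr -exprD !coefZ coefMXn.
  by rewrite addnn -mul2n ltd !mulr0.
- by apply: size_mul_leq szf1 szg0 _; lia.
- by apply: size_mul_leq szf0 szg _; lia.
Qed.

Theorem theorem4p3 (m q : nat) (hm : (2 < m)%N) (hq : q = (2 ^ m)%N)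
    (F : finFieldType) (hF : #|F| = q)
    (al : 'I_q -> F) (hal : bijective al)
    (k t h n : nat) (hk : (3 <= k)%N) (ht : (1 <= t)%N)
    (hth : (t + h <= k - 1)%N)
    (hk_lo : (q%:R - 2 * t%:R + 1) / 2 < k%:R :> rat)
    (hk_hi : k%:R < (q%:R - t%:R + 1) / 2 :> rat)
    (hn_lo : (2 * k + t <= n)%N) (hn_hi : (n <= q)%N)
    (eta : F) (heta : eta != 0)
    (idx : 'I_n -> 'I_q)
    (hidx : forall j1 j2 : 'I_n, (j1 < j2)%N -> (idx j1 < idx j2)%N)
    (alpha v : 'rV[F]_n)
    (halpha : forall j : 'I_n, alpha 0 j = al (idx j))
    (hv : forall j : 'I_n,
       v 0 j = \prod_(beta : F | beta \notin [seq al (idx l) | l : 'I_n])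
                 (al (idx j) - beta) ^+ (2 ^ (m - 1))) :
  self_orthogonal (eval_code (twisted_space k t h eta) alpha v).
Proof.
(* Equivalent to [q - 1 < 2 * (k - 1 + t)]: the product of the twists starts above degree
   [q - 1]. *)
have k_lo : (q + 1 < 2 * k + 2 * t)%N.
  by rewrite -(ltr_nat rat) 2!natrD 2!natrM; lra.
have idx_inj : injective idx.
  move=> i j eq_ij; apply/val_inj; have [lt|lt|//] := ltngtP (val i) (val j).
    by have := hidx _ _ lt; rewrite eq_ij ltnn.
  by have := hidx _ _ lt; rewrite eq_ij ltnn.
pose s := [seq al (idx l) | l : 'I_n].
have us : uniq s.
  by rewrite map_inj_uniq ?enum_uniq // => i j /(bij_inj hal) /idx_inj.
have szs : size s = n by rewrite size_map size_enum_ord.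
move=> _ [_ [a ->] ->] _ [_ [b ->] ->].
set f := twisted_poly k t h eta a; set g := twisted_poly k t h eta b.
have -> : inner_prod (\row_j (v 0 j * f.[alpha 0 j]))
    (\row_j (v 0 j * g.[alpha 0 j])) =
    \sum_(x <- s) (vanishing_poly s * (f * g)).[x].
  rewrite /s big_image /=; apply: eq_bigr => j _; rewrite !mxE halpha mulrACA.
  rewrite -expr2 hv (sqr_prod_half_card _ _ (m := m)) -?hq //; last by lia.
  by rewrite !hornerM.
have szP : size (vanishing_poly s) = (q - n).+1.
  by rewrite size_vanishing_poly // szs hF.
rewrite sum_seq_vanishing_poly //; apply: sum_horner_eq0; rewrite hF.
  have szfg : (size (f * g)%R <= 2 * (k - 1 + t) + 1)%N.
    by apply: size_mul_leq (size_twisted_poly _ _ _ _ _)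
      (size_twisted_poly _ _ _ _ _) _; lia.
  (* The product has size at most [q - 1 + t], and [t < q] follows from [2 * k + t <= n <= q]. *)
  by apply: size_mul_leq (eq_leq szP) szfg _; lia.
(* Here [d = q - 1], and the size condition becomes exactly [2 * k + t <= n]. *)
by apply: coef_mul_twisted_poly; rewrite ?szP; lia.
Qed.
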